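(* For every $k\in\mathbb{N}_{\ge1}$ and every $\bar d=(d_{r,s})_{r<s\in\mathbb{Q}\cap[0,1]}$ with $d_{r,s}\in\mathbb{N}$ there exists $\bar D=(D_{r,s})_{r<s\in\mathbb{Q}\cap[0,1]}$ with $D_{r,s}\in\mathbb{N}$ such that the following holds. Let $\left(V_{[k+2]},\mathcal{B}_{\bar n},\mu_{\bar n}\right)_{\bar n\in\mathbb{N}^{k+2}}$ be a $(k+2)$-partite graded probability space and $f:\prod_{i\in[k+2]}V_i\to[0,1]$ a $\mathcal{B}_{\bar 1^{k+2}}$-measurable function with $\operatorname{VC}_k(f)\le\bar d$. Then the function $f':\prod_{i\in[k+1]}V_i\to[0,1]$, $$f'(x_1,\dots,x_{k+1}):=\int f(x_1,\dots,x_{k+2})\,d\mu_{\bar\delta_{k+2}}(x_{k+2}),$$ satisfies $\operatorname{VC}_k(f')\le\bar D$.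
   Context: Graded probability spaces: for sets $V_1,\dots,V_m$ and $\bar n\in\mathbb{N}^m$, $V^{\bar n}=\prod_iV_i^{n_i}$, $\bar v\oplus\bar w=(\bar v_1,\bar w_1,\dots,\bar v_m,\bar w_m)$. An $m$-partite graded probability space consists of $\sigma$-algebras $\mathcal{B}_{\bar n}$ on $V^{\bar n}$ with probability measures $\mu_{\bar n}$ satisfying: invariance under permutations of coordinates within each block $V_i^{n_i}$; $\{\bar v\oplus\bar w:\bar v\in B,\bar w\in C\}\in\mathcal{B}_{\bar n+\bar n'}$ for $B\in\mathcal{B}_{\bar n},C\in\mathcal{B}_{\bar n'}$; Fubini: for $B\in\mathcal{B}_{\bar n+\bar n'}$, fibers $B_{\bar w}=\{\bar v:\bar v\oplus\bar w\in B\}$ lie in $\mathcal{B}_{\bar n}$, $\bar w\mapsto\mu_{\bar n}(B_{\bar w})$ is $\mathcal{B}_{\bar n'}$-measurable and $\mu_{\bar n+\bar n'}(B)=\int\mu_{\bar n}(B_{\bar w})d\mu_{\bar n'}(\bar w)$. $\bar\delta_{k+2}$ is the tuple with $1$ in position $k+2$ and $0$ elsewhere, so $\mu_{\bar\delta_{k+2}}$ is the measure on $V_{k+2}$; $\bar 1^m=(1,\dots,1)$. $\operatorname{VC}_k$ of functions: for $h:\prod_{i\in[k+1]}W_i\to[0,1]$ and $r<s$, a box $A=A_1\times\dots\times A_k$ ($A_i\subseteq W_i$) is $(r,s)$-shattered by $h$ if for every $S\subseteq A$ some $c_S\in W_{k+1}$ has $h(\bar a,c_S)\le r$ for $\bar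 a\in S$ and $h(\bar a,c_S)\ge s$ for $\bar a\in A\setminus S$; $\operatorname{VC}_k(h)\le\bar d$ means for every $r<s$ no box with all sides of size $d_{r,s}$ is $(r,s)$-shattered. For the $(k+2)$-ary $f$, $\operatorname{VC}_k(f)\le\bar d$ means that for every $j\in[k+2]$ and every $b\in V_j$, the $(k+1)$-ary fiber of $f$ obtained by fixing the $j$-th coordinate to $b$ (remaining coordinates in increasing order) has $\operatorname{VC}_k\le\bar d$. *)

(* Defs.v *)
From HB Require Import structures.
From mathcomp Require Import all_boot all_order all_fingroup all_algebra.
From mathcomp Require Import all_classical all_reals all_analysis.
From mathcomp Require Import measurable_realfun.

Set Implicit Arguments.
Unset Strict Implicit.
Unset Printing Implicit Defensive.

Import Order.TTheory GRing.Theory Num.Theory.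

Local Open Scope classical_set_scope.
Local Open Scope ring_scope.

(* The index set [m] = {1, ..., m} is 'I_m, so position i is the ordinal
   i - 1; in particular the last position k + 2 is (ord_max : 'I_k.+2). *)

Section Insertion.
Variables (n : nat) (W : 'I_n.+1 -> Type).

(* The point with coordinate b at position j and the coordinates of a, in
   increasing order, at the other positions: i |-> lift j i is the increasing
   enumeration of the positions different from j. *)
Definition insert_coord (j : 'I_n.+1) (b : W j)
    (a : forall i : 'I_n, W (lift j i)) : forall i : 'I_n.+1, W i :=
  fun i => match unliftP j i with
           | UnliftSome l il => eq_rect _ W (a l) _ (esym il)
           | UnliftNone ij => eq_rect _ W b _ (esym ij)
           end.

Lemma insert_coord_id j b a : @insert_coord j b a j = b.
Proof.
rewrite /insert_coord; case: unliftP => [l jl|jj].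
  by exfalso; move/eqP: jl; rewrite (negbTE (neq_lift j l)).
by rewrite (eq_irrelevance (esym jj) erefl).
Qed.

Lemma insert_coord_lift j b a l : @insert_coord j b a (lift j l) = a l.
Proof.
rewrite /insert_coord; case: unliftP => [l' ll'|lj].
  have ell' := lift_inj ll'; case: l' / ell' ll' => ll'.
  by rewrite (eq_irrelevance (esym ll') erefl).
by exfalso; move/eqP: lj; rewrite eq_sym (negbTE (neq_lift j l)).
Qed.

End Insertion.

Section GradedProbabilitySpace.
Variables (m : nat) (V : 'I_m -> pointedType).

Definition gpow (n : 'I_m -> nat) : Type := forall i : 'I_m, 'I_(n i) -> V i.

HB.instance Definition _ n :=
  Pointed.copy (gpow n) (forall i : 'I_m, 'I_(n i) -> V i).

Definition gadd (n n' : 'I_m -> nat) : 'I_m -> nat := fun i => (n i + n' i)%N.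

Definition gcat (n n' : 'I_m -> nat) (v : gpow n) (w : gpow n') :
    gpow (gadd n n') :=
  fun i a => match fintype.split a with inl b => v i b | inr c => w i c end.

Definition gperm (n : 'I_m -> nat) (s : forall i, 'S_(n i)) (v : gpow n) :
  gpow n := fun i a => v i (s i a).

(* The points of V ^ (1, ..., 1) are those of the product of the V i, and the
   points of V ^ delta_j are those of V j. *)
Definition gpow1_point (v : gpow (fun=> 1%N)) : forall i, V i :=
  fun i => v i ord0.

Definition gdelta (j : 'I_m) : 'I_m -> nat := fun i => (i == j).

Lemma gdelta_gt0 (j : 'I_m) : (0 < gdelta j j)%N.
Proof. by rewrite /gdelta eqxx. Qed.

Definition gdelta_point (j : 'I_m) (v : gpow (gdelta j)) : V j :=
  v j (Ordinal (gdelta_gt0 j)).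

End GradedProbabilitySpace.

Unset Implicit Arguments.

(* Taking each V i pointed is no restriction: gmu (gdelta i) is a probability
   measure on V i, which is therefore nonempty.  Since galg n is a
   sigma-algebra, the measurable sets of g_sigma_algebraType (galg n) are
   exactly those of galg n. *)
Record gradedProbSpace (R : realType) (m : nat) (V : 'I_m -> pointedType) := {
  galg : forall n : 'I_m -> nat, set (set (gpow V n)) ;
  galg_sigma : forall n, sigma_algebra setT (galg n) ;
  gmu : forall n, probability (g_sigma_algebraType (galg n)) R ;
  galg_perm : forall n (s : forall i, 'S_(n i)) (B : set (gpow V n)),
    galg n B -> galg n (gperm s @^-1` B) ;
  gmu_perm : forall n (s : forall i, 'S_(n i)) (B : set (gpow V n)),
    galg n B -> gmu n (gperm s @^-1` B) = gmu n B ;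
  galg_prod : forall n n' (B : set (gpow V n)) (C : set (gpow V n')),
    galg n B -> galg n' C ->
    galg (gadd n n') [set gcat v w | v in B & w in C] ;
  galg_fiber : forall n n' (B : set (gpow V (gadd n n'))),
    galg (gadd n n') B ->
    forall w : gpow V n', galg n [set v : gpow V n | B (gcat v w)] ;
  gmu_fiber_measurable :
    forall n n' (B : set (gpow V (gadd n n'))),
    galg (gadd n n') B ->
    measurable_fun [set: g_sigma_algebraType (galg n')]
      (fun w => gmu n [set v : gpow V n | B (gcat v w)]) ;
  gmu_fubini : forall n n' (B : set (gpow V (gadd n n'))),
    galg (gadd n n') B ->
    gmu (gadd n n') B =
    (\int[gmu n']_w gmu n [set v : gpow V n | B (gcat v w)])%E
}.

Set Implicit Arguments.

Arguments gradedProbSpace R {m} V.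
Arguments galg {R m V} _ _.
Arguments gmu {R m V} _ _.

Section VCk.
Variable R : realType.

(* In the (k + 1)-ary case the first k positions are lift ord_max i, i : 'I_k,
   and the last one is ord_max. *)
Section Functions.
Variables (k : nat) (W : 'I_k.+1 -> Type).

Definition box (A : forall i : 'I_k, set (W (lift ord_max i))) :
    set (forall i : 'I_k, W (lift ord_max i)) :=
  [set a | forall i, A i (a i)].

Definition shattered (h : (forall i, W i) -> R) (r s : R)
    (A : forall i : 'I_k, set (W (lift ord_max i))) : Prop :=
  forall S, S `<=` box A -> exists c : W ord_max,
    (forall a, S a -> h (insert_coord c a) <= r) /\
    (forall a, (box A `\` S) a -> s <= h (insert_coord c a)).

(* Only the values d r s with 0 <= r < s <= 1 matter. *)
Definition VC_le (h : (forall i, W i) -> R) (d : rat -> rat -> nat) : Prop :=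
  forall r s : rat, 0 <= r -> r < s -> s <= 1 ->
  forall A : forall i : 'I_k, set (W (lift ord_max i)),
    (forall i, (A i #= `I_(d r s))%card) -> ~ shattered h (ratr r) (ratr s) A.

End Functions.

Definition VC_fibers_le (k : nat) (V : 'I_k.+2 -> Type)
    (f : (forall i, V i) -> R) (d : rat -> rat -> nat) : Prop :=
  forall (j : 'I_k.+2) (b : V j),
    VC_le (W := fun i : 'I_k.+1 => V (lift j i))
      (fun a => f (insert_coord b a)) d.

Definition average_last (k : nat) (V : 'I_k.+2 -> pointedType)
    (G : gradedProbSpace R V) (f : (forall i, V i) -> R)
    (x : forall i : 'I_k.+1, V (lift ord_max i)) : R :=
  \int[gmu G (gdelta ord_max)]_y
    f (insert_coord (W := fun i => V i) (gdelta_point y) x).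

End VCk.

(* Main.v *)
(* Suppose a large box is shattered by the average f' of f over z, with witnesses
   c_S for the subsets S of the box.  Averaging the correlation of f'(., c_S) with
   the signs of S over all S, and exchanging with the integral, yields a single z
   for which the functions a |-> f(a, c_S, z) correlate with the signs of S on
   average.  Rounding to thresholds j/N with N large, some pair of consecutive
   thresholds j/N < (j+1)/N keeps the correlation while very few values fall in the
   gap.  An exponential moment bound then forces exponentially many rounded
   patterns with one and the same gap set, so by Sauer-Shelah-Pajor a subset of
   positive density of the box is shattered with gap.  When the sides of the box
   grow fast enough, such a subset contains a box with prescribed sides,
   contradicting VC_k(f(., z)) <= d. *)
Require Import Defs.
From mathcomp Require Import all_boot all_order all_algebra.
From mathcomp Require Import all_classical all_reals all_analysis.
From mathcomp Require Import measurable_realfun.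
From mathcomp Require Import ring lra zify.

Set Implicit Arguments.
Unset Strict Implicit.
Unset Printing Implicit Defensive.

Import Order.TTheory GRing.Theory Num.Theory.

Section FiniteCombinatorics.

Import fintype boot.finset.

Local Open Scope set_scope.
Local Open Scope ring_scope.

(** * Shattering in finite set systems *)

Definition shatters (T : finType) (F : {set {set T}}) (B : {set T}) : bool :=
  [forall X : {set T}, (X \subset B) ==> [exists S in F, S :&: B == X]].

Lemma shattersP (T : finType) (F : {set {set T}}) (B : {set T}) :
  reflect (forall X : {set T}, X \subset B -> exists2 S, S \in F & S :&: B = X)
          (shatters F B).
Proof.
apply: (iffP forallP) => [H X XB|H X].
  by have /implyP/(_ XB)/exists_inP[S SF /eqP SX] := H X; exists S.
by apply/implyP => /H[S SF SX]; apply/exists_inP; exists S => //; apply/eqP.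
Qed.

Lemma shattersS (T : finType) (F G : {set {set T}}) (B : {set T}) :
  F \subset G -> shatters F B -> shatters G B.
Proof.
move=> /subsetP FG /shattersP FB; apply/shattersP => X /FB[S SF SX].
by exists S => //; apply: FG.
Qed.

(* Pajor's form of the Sauer-Shelah lemma.  Splitting F at a point x that
   separates two of its members, a set shattered by both halves F0, F1 misses x,
   and adding x to it gives a further set shattered by F. *)
Lemma card_le_shattered (T : finType) (F : {set {set T}}) :
  (#|F| <= #|[set B | shatters F B]|)%N.
Proof.
have [n] := ubnP #|F|; elim: n F => // n IHn F Fn.
have [F1|F1] := leqP #|F| 1.
  have [->|[S SF]] := set_0Vmem F; first by rewrite cards0.
  apply: (leq_trans F1); rewrite card_gt0; apply/set0Pn; exists finset.set0.
  rewrite inE; apply/shattersP => X; rewrite subset0 => /eqP->.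
  by exists S => //; rewrite setI0.
have /card_gt1P[A [B [AF BF AB]]] := F1.
have [x xAB] : exists x, (x \in A) != (x \in B).
  apply/existsP; apply: contraNT AB; rewrite negb_exists => /forallP H.
  by apply/eqP/setP => x; apply/eqP; have := H x; rewrite negbK.
pose G (b : bool) := [set S in F | (x \in S) == b].
have GF b : G b \subset F by apply/subsetP => S; rewrite inE => /andP[].
have FG : #|F| = (#|G true| + #|G false|)%N.
  rewrite -(cardsID [set S : {set T} | x \in S] F); congr (_ + _)%N.
    by apply: eq_card => S; rewrite !inE eqb_id.
  by apply: eq_card => S; rewrite !inE eqbF_neg andbC.
have Gb b : (0 < #|G b|)%N.
  rewrite card_gt0; apply/set0Pn.
  by move: xAB; case: b; case xA: (x \in A); case xB: (x \in B) => // _;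
    [exists A|exists B|exists B|exists A]; rewrite inE ?AF ?BF ?xA ?xB.
have Gn b : (#|G b| < n)%N.
  by have := Gb true; have := Gb false; case: b; rewrite FG in Fn; lia.
pose sh b := [set B | shatters (G b) B].
have shF b : sh b \subset [set B | shatters F B].
  by apply/subsetP => C; rewrite !inE; apply: shattersS.
have shx C b : C \in sh b -> x \notin C.
  rewrite inE => /shattersP sC; apply/negP => xC.
  (* The test trace contains [x] exactly when [b] is false, which no member of [G b] can realize. *)
  have [|S] := sC [set y in C | (y == x) && ~~ b].
    by apply/subsetP => y; rewrite inE => /andP[].
  rewrite inE => /andP[_ /eqP xS] /setP/(_ x).
  by rewrite !inE xC eqxx xS andbT /=; clear; case: b.
pose I := sh true :&: sh false.
have xI : [set x |: C | C in I] \subset [set B | shatters F B].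
  apply/subsetP => D /imsetP[C /setIP[C1 C0] ->{D}].
  have xC := shx _ _ C1; rewrite inE; apply/shattersP => X XC.
  (* The half is picked by whether [x] lies in [X]; only the trace on [C] then remains to be
     realized. *)
  have XxC : X :\ x \subset C by rewrite subDset.
  have [S SG SX] : exists2 S, S \in G (x \in X) & S :&: C = X :\ x.
    by move: C1 C0; rewrite !inE; case: (x \in X) => /shattersP h1 /shattersP h0;
      [apply: h1|apply: h0].
  move: SG; rewrite inE => /andP[SF /eqP xS]; exists S => //.
  apply/setP => y; have /setP/(_ y) := SX; rewrite !inE.
  case: (y =P x) => [->|_] /=; first by rewrite xS andbT.
  by move=> ->.
have cI : #|[set x |: C | C in I]| = #|I|.
  apply: card_in_imset => C1 C2; rewrite !inE => /andP[C11 _] /andP[C21 _] E.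
  have x1 : x \notin C1 by apply: (shx C1 true); rewrite inE.
  have x2 : x \notin C2 by apply: (shx C2 true); rewrite inE.
  by rewrite -(setU1K x1) E setU1K.
have dI : [disjoint [set x |: C | C in I] & sh true :|: sh false].
  rewrite disjoint_subset; apply/subsetP => _ /imsetP[C _ ->].
  rewrite !inE; apply/negP => /orP[] h.
    by have := shx (x |: C) true; rewrite !inE h eqxx => /(_ isT).
  by have := shx (x |: C) false; rewrite !inE h eqxx => /(_ isT).
have IH b : (#|G b| <= #|sh b|)%N by apply: IHn.
apply: (@leq_trans #|[set x |: C | C in I] :|: (sh true :|: sh false)|); last first.
  by apply: subset_leq_card; rewrite !subUset xI !shF.
have := leq_card_setU [set x |: C | C in I] (sh true :|: sh false).
rewrite dI => -[_ /eqP ->].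
rewrite cI FG [leqRHS]addnC cardsUI; exact: leq_add.
Qed.

(** * Exponential moments and counting *)

(** Jensen's inequality for the exponential, read off from its tangent line at [m]. *)
Lemma expR_mean_le (R : realType) (T : finType) (Y : T -> R) (m : R) :
  #|T|%:R * m <= \sum_x Y x -> #|T|%:R * expR m <= \sum_x expR (Y x).
Proof.
move=> mY.
have h x : expR m * (1 + (Y x - m)) <= expR (Y x).
  have -> : expR (Y x) = expR m * expR (Y x - m) by rewrite -expRD addrC subrK.
  by rewrite ler_wpM2l ?expR_ge0// expR_ge1Dx.
apply: le_trans (ler_sum _ (fun x _ => h x)).
rewrite -mulr_sumr big_split/= sumr_const sumrB/= sumr_const.
rewrite mulrC ler_wpM2l ?expR_ge0//.
by rewrite -(mulr_natl m) lerDl subr_ge0.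
Qed.

(** Chernoff-type argument: with weight exp(-t|B|) on every set B, the total weight is (1 +
    exp(-t))^|T|, at most exp(exp(-t)|T|), while each member of [F] weighs at least exp(-tb|T|). *)
Lemma card_le_small_sets (R : realType) (T : finType) (F : {set {set T}})
    (b t : R) : 0 <= t ->
  (forall B, B \in F -> #|B|%:R <= b * #|T|%:R) ->
  #|F|%:R <= expR ((t * b + expR (- t)) * #|T|%:R).
Proof.
move=> t0 FB.
have h B : B \in F ->
    1 <= expR (t * b * #|T|%:R) * \prod_a (if a \in B then expR (- t) else 1).
  move=> /FB Bb; rewrite -big_mkcond/= prodr_const -expRM_natr -expRD.
  by rewrite -[leLHS]expR0 ler_expR mulNr subr_ge0 -mulrA ler_wpM2l.
rewrite -sum1_card natr_sum; apply: le_trans (ler_sum _ h) _.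
rewrite -mulr_sumr mulrDl expRD ler_wpM2l ?expR_ge0//.
apply: (@le_trans _ _ (\prod_(a : T) (expR (- t) + 1))).
  rewrite bigA_distr/= big_mkcond/= [leRHS]big_mkcond/=; apply: ler_sum => B _.
  case: ifP => // _; apply: prodr_ge0 => a _.
  by case: ifP => // _; exact: expR_ge0.
rewrite prodr_const expRM_natr lerXn2r ?nnegrE ?addr_ge0 ?expR_ge0//.
by rewrite addrC expR_ge1Dx.
Qed.

(** * Gap patterns against random sets *)

Lemma card_set_type (T : finType) : #|{set T}| = (2 ^ #|T|)%N.
Proof.
rewrite -[in RHS]cardsT -card_powerset; apply: eq_card => S.
by rewrite !inE subsetT.
 Qed.

(* A pattern value Some true predicts a \in S, Some false predicts a \notin S, and
   None is a value in the gap, penalized by K. *)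
Definition sign_score (R : realType) (K : R) (b : bool) (o : option bool) : R :=
  if o is Some c then (if c == b then 1 else -1) else - K.

(** By [1 + y <= expR y] at [x] and [- x], the left side times [1 - x ^+ 2] is at most 2. The
    exponent is not sharp, which lets this one inequality suffice. *)
Lemma expR_cosh_le (R : realType) (x : R) : 0 <= x -> x <= 2^-1 ->
  expR x + expR (- x) <= 2 * expR (2 * x ^+ 2).
Proof.
move=> x0 x1.
have hp := expR_ge1Dx x; have hn := expR_ge1Dx (- x).
have e1 : expR x * expR (- x) = 1 by rewrite -expRD subrr expR0.
have h2 := expR_ge1Dx (2 * x ^+ 2).
have p0 := expR_gt0 x; have n0 := expR_gt0 (- x).
have a1 : expR x * (1 - x) <= 1 by rewrite -[leRHS]e1 ler_pM2l.
have a2 : expR (- x) * (1 + x) <= 1 by rewrite -[leRHS]e1 mulrC ler_pM2r.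
have b1 : expR x * (1 - x ^+ 2) <= 1 + x.
  rewrite (_ : _ * _ = expR x * (1 - x) * (1 + x)); last by ring.
  by rewrite ler_piMl// addr_ge0.
have b2 : expR (- x) * (1 - x ^+ 2) <= 1 - x.
  rewrite (_ : _ * _ = expR (- x) * (1 + x) * (1 - x)); last by ring.
  by rewrite ler_piMl//; lra.
have d0 : 0 < 1 - x ^+ 2 by nra.
have : (expR x + expR (- x)) * (1 - x ^+ 2) <=
       2 * expR (2 * x ^+ 2) * (1 - x ^+ 2).
  apply: (@le_trans _ _ 2); first by lra.
  have y0 : 0 <= x ^+ 2 by exact: sqr_ge0.
  have y1 : x ^+ 2 <= 2^-1 by nra.
  have : 1 <= (1 + 2 * x ^+ 2) * (1 - x ^+ 2) by nra.
  have : (1 + 2 * x ^+ 2) * (1 - x ^+ 2) <= expR (2 * x ^+ 2) * (1 - x ^+ 2).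
    by rewrite ler_wpM2r// ltW.
  lra.
by rewrite ler_pM2r.
Qed.

(* For a fixed pattern p the exponential moment over a uniformly random S
   factorizes over the points. *)
Lemma sum_expR_score (R : realType) (T : finType) (K l : R)
    (p : {ffun T -> option bool}) : 0 <= l -> l <= 2^-1 ->
  \sum_(S : {set T}) expR (l * \sum_a sign_score K (a \in S) (p a)) <=
  expR (2 * l ^+ 2) ^+ #|T| * 2 ^+ #|T| *
    \prod_a (if p a == None then expR (- (l * K)) else 1).
Proof.
move=> l0 l1.
rewrite (_ : \sum_(S : {set T}) _ =
    \prod_a (expR (l * sign_score K true (p a)) +
             expR (l * sign_score K false (p a)))); last first.
  rewrite bigA_distr/=; apply: eq_bigr => S _.
  rewrite mulr_sumr expR_sum; apply: eq_bigr => a _.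
  by case: ifP.
rewrite -exprMn -prodr_const -big_split/=; apply: ler_prod => a _.
rewrite addr_ge0 ?expR_ge0//=.
case: (p a) => [c|] /=.
  rewrite mulr1 [leRHS]mulrC; apply: le_trans (expR_cosh_le l0 l1).
  by case: c; rewrite /= mulr1 mulrN1 // addrC.
rewrite mulrN.
have := expR_ge1Dx (2 * l ^+ 2); have := expR_gt0 (- (l * K)).
set x := expR _; set y := expR _ => x0 y1.
have : 0 <= l ^+ 2 by exact: sqr_ge0.
nra.
Qed.

(** Once the gap set [E] is fixed, a pattern is determined by its [Some true] points, so patterns
    form a set system. Pajor's bound counts it by its shattered sets, all of density at most [b]. *)
Lemma card_patterns_le (R : realType) (T : finType)
    (P : {set {ffun T -> option bool}}) (b t : R) : 0 <= t ->
  (forall B : {set T}, b * #|T|%:R <= #|B|%:R ->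
    exists2 X : {set T}, X \subset B &
      forall p, p \in P -> exists2 a, a \in B & p a != Some (a \in X)) ->
  forall E : {set T}, #|[set p in P | [set a | p a == None] == E]|%:R <=
    expR ((t * b + expR (- t)) * #|T|%:R).
Proof.
move=> t0 noB E; set PE := [set p in P | _].
pose tr (p : {ffun T -> option bool}) := [set a | p a == Some true].
have inE' p : p \in PE -> p \in P /\ forall a, (a \in E) = (p a == None).
  by rewrite inE => /andP[pP /eqP <-]; split => // a; rewrite inE.
have cPE : #|PE| = #|tr @: PE|.
  rewrite card_in_imset// => p1 p2 /inE'[_ E1] /inE'[_ E2] /setP e.
  apply/ffunP => a; have := e a; have := E1 a; have := E2 a; rewrite !inE.
  by case: (a \in E); case: (p1 a) => [[]|]; case: (p2 a) => [[]|].
apply: (@le_trans _ _ (#|[set B | shatters (tr @: PE) B]|%:R)).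
  by rewrite ler_nat cPE card_le_shattered.
apply: card_le_small_sets => // B; rewrite inE => /shattersP sB.
rewrite leNgt; apply/negP => /ltW /noB[X XB noX].
(* The trace [B] comes from a pattern equal to [Some true] on [B], so [B] misses [E]. The pattern
   with trace [X] then has no gap on [B] and is [Some (a \in X)] throughout. *)
have [_ /imsetP[p pPE ->] pB] := sB B (subxx _).
have [_ /imsetP[p' p'PE ->] p'X] := sB X XB.
have [pP pE] := inE' _ pPE; have [p'P p'E] := inE' _ p'PE.
have [a aB /negP[]] := noX _ p'P.
have /setP/(_ a) := pB; have /setP/(_ a) := p'X.
have := pE a; have := p'E a; rewrite !inE aB !andbT => -> e <- /eqP pa.
by move: e; rewrite pa; case: (p' a) => [[]|].
Qed.

(** If no dense set is shattered with gap, few patterns share a gap set, and the penalty [K] damps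
    those with large gap sets; the exponential moment is then too small for the assumed mean
    score. *)
Lemma dense_shattered (R : realType) (th : R) : 0 < th -> th <= 1 ->
  exists K b : R, [/\ 0 <= K, 0 < b & forall (T : finType)
    (q : {set T} -> {ffun T -> option bool}), (0 < #|T|)%N ->
    2 ^+ #|T| * (th * #|T|%:R) <=
      \sum_(S : {set T}) \sum_a sign_score K (a \in S) (q S a) ->
    exists2 B : {set T}, b * #|T|%:R <= #|B|%:R &
      forall X : {set T}, X \subset B ->
        exists S, forall a, a \in B -> q S a = Some (a \in X)].
Proof.
move=> th0 th1.
(* [l] maximizes [l * th - 2 * l ^+ 2], with maximum [tau]. The choice of [t] and of the density
   [tau ^+ 2 / 16] makes their product [tau / 4] and [expR (- t)] at most [tau / 4], so the upper
   bound has exponent at most 3/4 of [tau] per point. *)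
pose l := th / 4; pose tau := th ^+ 2 / 8; pose t := 4 / tau.
have tau0 : 0 < tau by rewrite /tau; nra.
have t0 : 0 < t by rewrite divr_gt0.
have l0 : 0 < l by rewrite /l; lra.
have tt : t * tau = 4 by rewrite /t divfK// gt_eqF.
exists (t / l), (tau ^+ 2 / 16); split; first by rewrite divr_ge0// ltW.
  by rewrite divr_gt0// exprn_gt0.
move=> T q T0 qS; set M := #|T|%:R in qS *.
have M0 : 0 < M by rewrite ltr0n.
apply: contrapT => noB.
have noB' (B : {set T}) : tau ^+ 2 / 16 * M <= #|B|%:R ->
    exists2 X : {set T}, X \subset B &
      forall p, p \in q @: finset.setT -> exists2 a, a \in B & p a != Some (a \in X).
  move=> Bb; apply: contrapT => noX; apply: noB; exists B => // X XB.
  apply: contrapT => noS; apply: noX; exists X => // p /imsetP[S _ ->].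
  apply: contrapT => noa; apply: noS; exists S => a aB.
  by apply/eqP/negPn/negP => qa; apply: noa; exists a.
have cP := card_patterns_le (ltW t0) noB'.
set C := expR _ in cP.
have lK : l * (t / l) = t by rewrite mulrC divfK// gt_eqF.
have jensen : 2 ^+ #|T| * expR (l * (th * M)) <=
    \sum_(S : {set T}) expR (l * \sum_a sign_score (t / l) (a \in S) (q S a)).
  have := @expR_mean_le _ {set T}
    (fun S => l * \sum_a sign_score (t / l) (a \in S) (q S a)) (l * (th * M)).
  rewrite card_set_type natrX; apply.
  by rewrite -mulr_sumr mulrCA ler_pM2l.
(* Summing over all patterns in the image, instead of taking [q S] alone, decouples the pattern from
   [S]. *)
have upper : \sum_(S : {set T})
      expR (l * \sum_a sign_score (t / l) (a \in S) (q S a)) <=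
    \sum_(p in q @: finset.setT) \sum_(S : {set T})
      expR (l * \sum_a sign_score (t / l) (a \in S) (p a)).
  rewrite exchange_big/=; apply: ler_sum => S _.
  rewrite (bigD1 (q S)) ?imset_f//= lerDl; apply: sumr_ge0 => p _.
  exact: expR_ge0.
have upper2 : \sum_(p in q @: finset.setT) \sum_(S : {set T})
      expR (l * \sum_a sign_score (t / l) (a \in S) (p a)) <=
    expR (2 * l ^+ 2) ^+ #|T| * 2 ^+ #|T| * \sum_(p in q @: finset.setT)
      \prod_a (if p a == None then expR (- t) else 1).
  rewrite mulr_sumr; apply: ler_sum => p _; rewrite -[in leRHS]lK.
  by apply: sum_expR_score; rewrite ?(ltW l0)// /l; lra.
(* Patterns are grouped by gap set [E]: each group has at most [C] members of weight exp(-t|E|), and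
   these weights sum over all [E] to (1 + exp(-t))^|T|. *)
have upper3 : \sum_(p in q @: finset.setT)
      \prod_a (if p a == None then expR (- t) else 1) <=
    C * expR (expR (- t)) ^+ #|T|.
  rewrite (partition_big (fun p : {ffun T -> option bool} => [set a | p a == None])
    predT)//=.
  apply: (@le_trans _ _ (C * \prod_(a : T) (expR (- t) + 1))); last first.
    rewrite prodr_const ler_wpM2l ?expR_ge0// lerXn2r ?nnegrE ?addr_ge0 ?expR_ge0//.
    by rewrite addrC expR_ge1Dx.
  rewrite bigA_distr/= mulr_sumr; apply: ler_sum => E _.
  rewrite (eq_bigr (fun=> \prod_a (if a \in E then expR (- t) else 1))); last first.
    by move=> p /andP[_ /eqP <-]; apply: eq_bigr => a _; rewrite inE.
  rewrite -big_mkcond/= prodr_const sumr_const -mulr_natl.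
  rewrite ler_wpM2r ?exprn_ge0 ?expR_ge0//.
  apply: le_trans (cP E); rewrite ler_nat; apply: subset_leq_card.
  by apply/subsetP => p; rewrite !inE.
have : expR (l * (th * M)) <=
    expR (2 * l ^+ 2) ^+ #|T| * (C * expR (expR (- t)) ^+ #|T|).
  have e2 : 0 < (2 ^+ #|T| : R) by rewrite exprn_gt0.
  rewrite -(ler_pM2l e2); apply: (le_trans jensen); apply: (le_trans upper).
  apply: (le_trans upper2); rewrite -mulrA mulrCA ler_pM2l//.
  by rewrite ler_wpM2l// exprn_ge0// expR_ge0.
rewrite /C -!expRM_natr -!expRD ler_expR -/M.
have et : expR (- t) * (1 + t) <= 1.
  rewrite -[leRHS](@expR0 R) -(addNr t) expRD ler_wpM2l ?expR_ge0//.
  exact: expR_ge1Dx.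
have et0 := expR_gt0 (- t); set x := expR _ in et et0 *.
have xt : 4 * x <= tau by nra.
have tb : t * (tau ^+ 2 / 16) = tau / 4.
  by transitivity (t * tau * tau / 16); [ring|rewrite tt; field].
have lth : l * th - 2 * l ^+ 2 = tau by rewrite /l /tau; field.
rewrite tb -!mulrDl mulrA ler_pM2r//; nra.
Qed.

(** * Rounding real values to levels *)

(** Shattering asks for low values on S, so membership carries the sign -1 and [level] reads a low
    value as predicting membership. *)
Definition set_sign (R : realType) (b : bool) : R := if b then -1 else 1.

Definition level (R : realType) (lo hi y : R) : option bool :=
  if y <= lo then Some true else if hi <= y then Some false else None.

Lemma sum_set_sign (R : realType) (T : finType) (a : T) :
  \sum_(S : {set T}) set_sign R (a \in S) = 0.
Proof.
have : \sum_(S : {set T}) set_sign R (a \in S) =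
    - \sum_(S : {set T}) set_sign R (a \in S).
  rewrite [LHS](reindex_inj (@setC_inj T))/= -sumrN; apply: eq_bigr => S _.
  by rewrite inE /set_sign; case: (a \in S); rewrite /= ?opprK.
by move=> h; lra.
Qed.

(** The two sums are the floor of [y] and [N] minus its ceiling. *)
Lemma level_counts (R : realType) (N : nat) (y : R) : 0 <= y -> y <= N%:R ->
  y - 1 <= \sum_(j < N) (j.+1%:R <= y)%R%:R <= y /\
  N%:R - y - 1 <= \sum_(j < N) (y <= j%:R)%R%:R <= N%:R - y.
Proof.
move=> y0 yN.
pose u n : R := \sum_(j < n) (j.+1%:R <= y)%R%:R.
pose l n : R := \sum_(j < n) (y <= j%:R)%R%:R.
(* The induction on [N] must also cover [N%:R <= y], where the counts are [N] and 0. *)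
suff [hle hlt] : (N%:R <= y -> u N = N%:R /\ l N = 0) /\
    (y < N%:R -> y - 1 <= u N <= y /\ N%:R - y - 1 <= l N <= N%:R - y).
  have [yN'|Ny] := ltP y N%:R; first exact: hlt.
  rewrite -/(u N) -/(l N).
  by have [-> ->] := hle Ny; split; lra.
elim: N {yN} => [|N [hle hlt]].
  by split; [rewrite /u /l !big_ord0|rewrite ltNge y0].
have uS : u N.+1 = u N + (N.+1%:R <= y)%R%:R by rewrite /u big_ord_recr.
have lS : l N.+1 = l N + (y <= N%:R)%R%:R by rewrite /l big_ord_recr.
have NS : N.+1%:R = N%:R + 1 :> R by rewrite natr1.
split=> [Ny|yN].
  have [uN lN] : u N = N%:R /\ l N = 0 by apply: hle; lra.
  by rewrite uS lS uN lN Ny NS; split=> //; case: leP => /= ?; lra.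
rewrite uS lS (leNgt N.+1%:R) yN/= addr0 NS; rewrite NS in yN.
have [yN'|yN'] := ltP y N%:R.
  by have [hu hl] := hlt yN'; rewrite (ltW yN')/=; split; lra.
have [-> ->] := hle yN'; split; first by lra.
by case: (leP y N%:R) => /= ?; lra.
Qed.

(** The score becomes linear in two threshold indicators, so that summing over levels reduces to
    [level_counts]. *)
Lemma sign_score_level (R : realType) (K lo hi y : R) (b : bool) : lo < hi ->
  sign_score K b (level lo hi y) =
  set_sign R b * ((hi <= y)%R%:R - (y <= lo)%R%:R) -
  K * (1 - (hi <= y)%R%:R - (y <= lo)%R%:R).
Proof.
rewrite /sign_score /level /set_sign => lohi.
have [ylo|ylo] := leP y lo; have [yhi|yhi] := leP hi y; case: b => /=; lra.
Qed.

(* Every value lies strictly between the thresholds of at most two levels, so for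
   large N the levels j/N are separated by a gap at almost no cost. *)
Lemma level_correlation (R : realType) (th K : R) : 0 < th -> 0 <= K ->
  exists2 N : nat, (0 < N)%N & forall (T : finType) (g : {set T} -> T -> R),
    (0 < #|T|)%N -> (forall S a, 0 <= g S a <= 1) ->
    2 ^+ #|T| * (th * #|T|%:R) <=
      \sum_(S : {set T}) \sum_a set_sign R (a \in S) * g S a ->
    exists2 j : nat, (j < N)%N & 2 ^+ #|T| * (th * #|T|%:R) <=
      \sum_(S : {set T}) \sum_a
        sign_score K (a \in S) (level (j%:R / N%:R) (j.+1%:R / N%:R) (g S a)).
Proof.
move=> th0 K0.
(* At each point the sum of the scores over the levels loses at most [1 + 2 * K]: 1 by rounding,
   [2 * K] by at most two gaps. The correlation enters with factor 2N, against N in the goal, and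
   the spare N [th] absorbs the loss. *)
have [n Nth] : exists n, 1 + 2 * K < n.+1%:R * th.
  exists (Num.truncn ((1 + 2 * K) / th)).
  rewrite -ltr_pdivrMr//.
  by have /Num.Theory.truncn_itv/andP[] : 0 <= (1 + 2 * K) / th
    by rewrite divr_ge0 ?(ltW th0)//; lra.
exists n.+1 => // T g T0 g01 corr; set N := n.+1 in Nth *.
have N0 : 0 < N%:R :> R by rewrite ltr0n.
set M := #|T|%:R in corr *; have M0 : 0 < M by rewrite ltr0n.
pose sc (j : 'I_N) := \sum_(S : {set T}) \sum_a
  sign_score K (a \in S) (level (j%:R / N%:R) (j.+1%:R / N%:R) (g S a)).
suff [j jP] : exists j, 2 ^+ #|T| * (th * M) <= sc j by exists j.
apply: contrapT => nsc.
have small : \sum_(j < N) sc j <= N%:R * (2 ^+ #|T| * (th * M)).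
  rewrite mulr_natl -[in leRHS](card_ord N) -sumr_const; apply: ler_sum => j _.
  by rewrite leNgt; apply/negP => /ltW h; apply: nsc; exists j.
have point (S : {set T}) (a : T) :
    set_sign R (a \in S) * (2 * (N%:R * g S a) - N%:R) - (1 + 2 * K) <= \sum_(j < N)
      sign_score K (a \in S) (level (j%:R / N%:R) (j.+1%:R / N%:R) (g S a)).
  have /andP[g0 g1] := g01 S a.
  have lev (j : 'I_N) :
      sign_score K (a \in S) (level (j%:R / N%:R) (j.+1%:R / N%:R) (g S a)) =
      set_sign R (a \in S) *
        ((j.+1%:R <= N%:R * g S a)%R%:R - (N%:R * g S a <= j%:R)%R%:R) -
      K * (1 - (j.+1%:R <= N%:R * g S a)%R%:R - (N%:R * g S a <= j%:R)%R%:R).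
    rewrite sign_score_level; last by rewrite ltr_pM2r ?invr_gt0// ltr_nat.
    by rewrite ler_pdivrMr// ler_pdivlMr// [N%:R * _]mulrC.
  rewrite (eq_bigr _ (fun j _ => lev j)) sumrB -!mulr_sumr !sumrB.
  rewrite sumr_const card_ord.
  have [||y1 y2] := @level_counts R N (N%:R * g S a).
  - by rewrite mulr_ge0.
  - by rewrite ler_piMr.
  set y := N%:R * g S a in y1 y2 *.
  set u := \sum_(_ < _) _ in y1 *; set l := \sum_(_ < _) _ in y2 *.
  rewrite /set_sign; case: (a \in S); nra.
have : \sum_(S : {set T}) \sum_a
    (set_sign R (a \in S) * (2 * (N%:R * g S a) - N%:R) - (1 + 2 * K)) <=
    \sum_(j < N) sc j.
  rewrite /sc [leRHS]exchange_big/=; apply: ler_sum => S _.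
  rewrite [leRHS]exchange_big/=.
  by apply: ler_sum => a _; apply: point.
rewrite (_ : \sum_(S : {set T}) _ =
    2 * N%:R * (\sum_(S : {set T}) \sum_a set_sign R (a \in S) * g S a) -
    (1 + 2 * K) * (2 ^+ #|T| * M)).
  have e0 : 0 < (2 ^+ #|T| : R) by rewrite exprn_gt0.
  have : N%:R * (2 ^+ #|T| * (th * M)) <= N%:R *
     (\sum_(S : {set T}) \sum_a set_sign R (a \in S) * g S a) by rewrite ler_pM2l.
  have : (1 + 2 * K) * (2 ^+ #|T| * M) < N%:R * th * (2 ^+ #|T| * M).
    by rewrite ltr_pM2r// mulr_gt0.
  lra.
under eq_bigr do rewrite sumrB sumr_const.
rewrite sumrB sumr_const card_set_type.
have -> : \sum_(S : {set T}) \sum_a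
    set_sign R (a \in S) * (2 * (N%:R * g S a) - N%:R) =
    2 * N%:R * (\sum_(S : {set T}) \sum_a set_sign R (a \in S) * g S a) -
    N%:R * \sum_(S : {set T}) \sum_a set_sign R (a \in S).
  rewrite !mulr_sumr -sumrB; apply: eq_bigr => S _.
  by rewrite !mulr_sumr -sumrB; apply: eq_bigr => a _; ring.
have -> : \sum_(S : {set T}) \sum_a set_sign R (a \in S) = 0.
  by rewrite exchange_big big1//= => a _; apply: sum_set_sign.
rewrite mulr0 subr0 -mulrnA -[(1 + 2 * K) *+ _]mulr_natr natrM natrX.
by rewrite [M * _]mulrC.
Qed.

(** * Boxes in dense subsets of grids *)

(** A nested product, so that sides can be added one at a time. *)
Fixpoint grid (ns : seq nat) : finType :=
  if ns is n :: ns' then ('I_n * grid ns')%type else unit.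

Fixpoint grid_coord (ns : seq nat) : grid ns -> nat -> nat :=
  match ns with
  | [::] => fun _ _ => 0%N
  | n :: ns' => fun a i => if i is i'.+1 then grid_coord a.2 i' else a.1 : nat
  end.

(* U i lists the i-th coordinates of the points of a box with sides of size d
   that is contained in B. *)
Definition contains_box (k d : nat) (ns : seq nat) (B : {set grid ns})
    (U : nat -> seq nat) : Prop :=
  (forall i, (i < k)%N ->
    [/\ uniq (U i), size (U i) = d & {subset U i <= iota 0 (nth 0%N ns i)}]) /\
  (forall x : nat -> nat, (forall i, (i < k)%N -> x i \in U i) ->
    exists2 a, a \in B & forall i, (i < k)%N -> grid_coord a i = x i).

(* The sides of the grid are chosen one after the other: once the fibers B_x are
   subsets of a fixed finite grid, d dense ones among them coincide. *)
Lemma dense_contains_box (R : realType) (k d : nat) (b : R) : 0 < b ->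
  exists ns : seq nat, [/\ size ns = k, (0 < #|grid ns|)%N &
    forall B : {set grid ns}, b * #|grid ns|%:R <= #|B|%:R ->
      exists U, contains_box k d B U].
Proof.
elim: k b => [|k IHk] b b0.
  exists [::]; split => //=; first by rewrite card_unit.
  move=> B; rewrite card_unit mulr1 => bB.
  have : (0 < #|B|)%N by rewrite -(ltr0n R) (lt_le_trans b0).
  rewrite card_gt0 => /set0Pn[a aB].
  by exists (fun=> [::]); split => // x _; exists a.
have [|ns [ns_k ns0 IH]] := IHk (b / 2); first by rewrite divr_gt0.
set Q := grid ns in ns0 IH *.
(* There are 2^|Q| possible fibers. If each dense one occurred at most [d] times, dense fibers would
   hold at most [c * #|Q|] points of [B] and sparse ones at most half of the assumed size; [n] makes
   the first share less than the other half. *)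
pose c : R := d%:R * 2 ^+ #|Q|.
have c0 : 0 <= c by rewrite mulr_ge0// exprn_ge0.
have [n cn] : exists n, c < b / 2 * n.+1%:R.
  exists (Num.truncn (c / (b / 2))).
  rewrite mulrC -ltr_pdivrMr ?divr_gt0//.
  by have /Num.Theory.truncn_itv/andP[] : 0 <= c / (b / 2)
    by rewrite divr_ge0// ltW// divr_gt0.
exists (n.+1 :: ns); split => /=; first by rewrite ns_k.
  by rewrite card_prod card_ord muln_gt0.
move=> B; rewrite card_prod card_ord natrM => Bb.
pose fib (x : 'I_n.+1) : {set Q} := [set a | (x, a) \in B].
have BE : #|B| = (\sum_x #|fib x|)%N.
  rewrite -sum1_card (eq_bigl (fun p => (p.1, p.2) \in B)); last by case.
  rewrite -(pair_big_dep xpredT (fun x a => (x, a) \in B) (fun _ _ => 1%N))/=.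
  by apply: eq_bigr => x _; rewrite sum1dep_card.
have [C dC Cb] : exists2 C : {set Q},
    (d <= #|[set x | fib x == C]|)%N & b / 2 * #|Q|%:R <= #|C|%:R.
  apply: contrapT => noC.
  have few (C : {set Q}) : b / 2 * #|Q|%:R <= #|C|%:R ->
      (#|[set x | fib x == C]| <= d)%N.
    by move=> Cb; rewrite leqNgt; apply/negP => /ltnW dC; apply: noC; exists C.
  have : #|B|%:R <= c * #|Q|%:R + n.+1%:R * (b / 2 * #|Q|%:R).
    have -> : c = \sum_(C : {set Q}) d%:R.
      by rewrite sumr_const card_set_type -[RHS]mulr_natr natrX.
    have -> : n.+1%:R = \sum_(C : {set Q}) #|[set x | fib x == C]|%:R :> R.
      rewrite -natr_sum; congr (_%:R); rewrite -[LHS]card_ord -sum1_card.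
      rewrite (partition_big fib predT)//=; apply: eq_bigr => C _.
      by rewrite sum1dep_card.
    rewrite BE (partition_big fib predT)//= natr_sum.
    rewrite !mulr_suml -big_split/=; apply: ler_sum => C _.
    rewrite (eq_bigr (fun=> #|C|)); last by move=> x /eqP ->.
    rewrite sum_nat_cond_const natrM.
    have [Cs|/ltW/few fd] := leP #|C|%:R (b / 2 * #|Q|%:R).
      rewrite addrC; apply: ler_wpDr; first by rewrite mulr_ge0.
      by rewrite ler_wpM2l.
    apply: ler_wpDr; first by rewrite !mulr_ge0// ltW// divr_gt0.
    by apply: ler_pM; rewrite // ler_nat// max_card.
  apply/negP; rewrite -ltNge; apply: lt_le_trans Bb.
  have Q0 : 0 < #|Q|%:R :> R by rewrite ltr0n.
  rewrite (_ : b * (_ * _) =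
    b / 2 * n.+1%:R * #|Q|%:R + n.+1%:R * (b / 2 * #|Q|%:R)); last by field.
  by rewrite ltrD2r ltr_pM2r.
have [U [U1 U2]] := IH C Cb.
(* The new first side consists of [d] points sharing the fiber [C]; the other sides come from the
   box inside [C]. *)
exists (fun i => if i is i'.+1 then U i' else
  [seq val x | x <- take d (enum [set x | fib x == C])]).
split=> [[_|i]|x xU].
- split.
  + by rewrite map_inj_uniq; [exact/take_uniq/enum_uniq|exact: val_inj].
  + by rewrite size_map size_takel// -cardE.
  + by move=> _ /mapP[x _ ->]; rewrite mem_iota /= ltn_ord.
- exact: U1.
- have [a aC ax] := U2 (fun i => x i.+1) (fun i ik => xU i.+1 ik).
  have /mapP[x0 /mem_take] := xU 0%N isT.
  rewrite mem_enum inE => /eqP fC x0E.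
  exists (x0, a); first by have := aC; rewrite -fC inE.
  by case=> [|i] //= ik; apply: ax.
Qed.

(** * From correlation to a shattered box *)

(** Chains rounding, gap shattering and box extraction. The grid is fixed before the level [j] is
    known, so it is built for the largest bound [d] at consecutive levels, and the box is trimmed
    afterwards. *)
Lemma box_of_correlation (R : realType) (k : nat) (d : rat -> rat -> nat)
    (th : R) : 0 < th -> th <= 1 ->
  exists (N : nat) (ns : seq nat), [/\ (0 < N)%N, size ns = k,
    (0 < #|grid ns|)%N & forall g : {set grid ns} -> grid ns -> R,
      (forall S a, 0 <= g S a <= 1) ->
      2 ^+ #|grid ns| * (th * #|grid ns|%:R) <=
        \sum_(S : {set grid ns}) \sum_a set_sign R (a \in S) * g S a ->
      exists (j : nat) (B : {set grid ns}) (U : nat -> seq nat),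
        [/\ (j < N)%N, contains_box k (d (j%:R / N%:R) (j.+1%:R / N%:R)) B U &
          forall X : {set grid ns}, exists S, forall a, a \in B ->
            if a \in X then g S a <= j%:R / N%:R else j.+1%:R / N%:R <= g S a]].
Proof.
move=> th0 th1.
have [K [b [K0 b0 dense]]] := dense_shattered th0 th1.
have [N N0 lev] := level_correlation th0 K0.
pose dmax := \max_(j < N) d (j%:R / N%:R) (j.+1%:R / N%:R).
have [ns [nsk ns0 box]] := dense_contains_box k dmax b0.
exists N, ns; split => // g g01 corr.
have [j jN jcorr] := lev _ g ns0 g01 corr.
pose q S := [ffun a => level (j%:R / N%:R) (j.+1%:R / N%:R) (g S a)].
have [|B Bb Bsh] := dense _ q ns0.
  apply: (le_trans jcorr); apply: ler_sum => S _; apply: ler_sum => a _.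
  by rewrite ffunE.
have [U [U1 U2]] := box B Bb.
have dj : (d (j%:R / N%:R) (j.+1%:R / N%:R) <= dmax)%N.
  exact: (leq_bigmax (Ordinal jN)).
exists j, B, (fun i => take (d (j%:R / N%:R) (j.+1%:R / N%:R)) (U i)); split => //.
  split=> [i ik|x xU].
    have [Uu Us Ui] := U1 i ik; split; first exact: take_uniq.
    - by rewrite size_takel ?Us.
    - by move=> n /mem_take/Ui.
  by apply: U2 => i ik; apply: mem_take (xU i ik).
move=> X; have [|S qS] := Bsh (X :&: B); first exact: subsetIr.
exists S => a aB; have := qS a aB; rewrite ffunE inE aB andbT /level.
by case: leP => // _; [|case: leP => // _]; case: (a \in X).
Qed.

Lemma grid_coord_lt (ns : seq nat) (a : grid ns) (i : nat) :
  (i < size ns)%N -> (grid_coord a i < nth 0%N ns i)%N.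
Proof. by elim: ns a i => [|n ns IH] a [|i] //= h; exact: IH. Qed.

Lemma grid_coord_inj (ns : seq nat) (a b : grid ns) :
  (forall i, (i < size ns)%N -> grid_coord a i = grid_coord b i) -> a = b.
Proof.
elim: ns a b => [|n ns IH]; first by case=> -[].
case=> [x a] [y b] h; congr pair; first by apply: val_inj; apply: (h 0%N).
by apply: IH => i; apply: (h i.+1).
Qed.

End FiniteCombinatorics.

Local Open Scope classical_set_scope.
Local Open Scope ring_scope.

(** * Averages over a probability space *)

Section Averages.
Context d (T : measurableType d) (R : realType) (mu : probability T R).

Lemma unit_valued_integrable (f : T -> R) : measurable_fun setT f ->
  (forall y, 0 <= f y <= 1) -> mu.-integrable setT (EFin \o f).
Proof.
move=> mf f01; apply: measurable_bounded_integrable => //.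
  exact: fin_num_fun_lty.
exists 1; split; first exact: num_real.
move=> c c1 y _; have /andP[f0 f1] := f01 y.
by rewrite /= ger0_norm// (le_trans f1)// ltW.
Qed.

Lemma Rintegral_sum_scale (I : Type) (s : seq I) (w : I -> R) (F : I -> T -> R) :
  (forall i, mu.-integrable setT (EFin \o F i)) ->
  mu.-integrable setT (EFin \o (fun y => \sum_(i <- s) w i * F i y)) /\
  \int[mu]_y (\sum_(i <- s) w i * F i y) = \sum_(i <- s) w i * \int[mu]_y F i y.
Proof.
move=> intF; elim: s => [|i s [IH1 IH2]].
  have -> : (fun y : T => \sum_(i <- [::]) w i * F i y) = cst 0.
    by apply/funext => y; rewrite big_nil.
  split; first by apply: unit_valued_integrable => // y /=; rewrite lexx ler01.
  by rewrite Rintegral_cst// mul0r big_nil.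
have -> : (fun y : T => \sum_(j <- i :: s) w j * F j y) =
    (fun y => w i * F i y + \sum_(j <- s) w j * F j y).
  by apply/funext => y; rewrite big_cons.
have wF : mu.-integrable setT (EFin \o (fun y => w i * F i y)).
  rewrite (_ : EFin \o _ = (fun y => (w i)%:E * (EFin \o F i) y)%E).
    exact: integrableZl.
  by apply/funext => y /=; rewrite EFinM.
split.
  rewrite (_ : EFin \o _ = ((EFin \o (fun y => (w i * F i y)%R)) \+
    (EFin \o (fun y => (\sum_(j <- s) w j * F j y)%R)))%E); first exact: integrableD.
  by apply/funext => y /=; rewrite EFinD.
by rewrite RintegralD// RintegralZl// IH2 big_cons.
Qed.

(** Otherwise the integrand stays below [c] and integrates to at most [c]; the slack [c < c'] makes
    nonstrict monotonicity of the integral enough. *)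
Lemma exists_ge_mean (I : Type) (s : seq I) (w : I -> R) (F : I -> T -> R)
    (c c' : R) : c < c' ->
  (forall i, measurable_fun setT (F i)) -> (forall i y, 0 <= F i y <= 1) ->
  c' <= \sum_(i <- s) w i * \int[mu]_y F i y ->
  exists y, c <= \sum_(i <- s) w i * F i y.
Proof.
move=> cc' mF F01 c'le; apply: contrapT => noy.
have [|intS intE] := @Rintegral_sum_scale I s w F.
  by move=> i; apply: unit_valued_integrable.
have : \int[mu]_y (\sum_(i <- s) w i * F i y) <= \int[mu]_y (cst c y).
  apply: le_Rintegral => //.
    by apply: finite_measure_integrable_cst.
  by move=> y _; rewrite leNgt; apply/negP => /ltW ?; apply: noy; exists y.
have -> : \int[mu]_y (cst c y) = c.
  rewrite Rintegral_cst// -[RHS]mulr1; congr (c * _).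
  by have /(congr1 fine) := @probability_setT _ _ _ mu.
rewrite intE => h.
by have := lt_le_trans cc' (le_trans c'le h); rewrite ltxx.
Qed.

End Averages.

(** * The VC bound for averages *)

Lemma ratr_level (R : realType) (j N : nat) :
  ratr (j%:R / N%:R : rat) = j%:R / N%:R :> R.
Proof. by rewrite fmorph_div/= !ratr_nat. Qed.

Lemma card_set_seq_image (U : Type) (e : nat -> U) (s : seq nat) :
  uniq s -> {in s &, injective e} ->
  ([set e n | n in [set` s]] #= `I_(size s))%card.
Proof.
move=> us einj; have -> : [set e n | n in [set` s]] =
    [set e (nth 0%N s i) | i in `I_(size s)].
  apply/seteqP; split=> [_ [n /= ns <-]|_ [i /= si <-]].
    by exists (index n s); rewrite /= ?index_mem ?nth_index.
  by exists (nth 0%N s i) => //=; exact: mem_nth.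
apply: inj_card_eq => i j /set_mem /= si /set_mem /= sj.
by move=> /einj/eqP; rewrite !mem_nth// nth_uniq// => /(_ isT isT)/eqP.
Qed.

Lemma VC_le_average (R : realType) (k : nat) (d : rat -> rat -> nat) :
  exists D : rat -> rat -> nat,
  forall (disp : measure_display) (T : measurableType disp)
    (mu : probability T R) (W : 'I_k.+1 -> pointedType)
    (F : T -> (forall i, W i) -> R),
    (forall y x, 0 <= F y x <= 1) -> (forall x, measurable_fun setT (F^~ x)) ->
    (forall y, VC_le (W := W) (F y) d) ->
    VC_le (W := W) (fun x => \int[mu]_y F y x) D.
Proof.
suff /choice[D DP] : forall rs : rat * rat, exists n : nat,
    0 <= rs.1 -> rs.1 < rs.2 -> rs.2 <= 1 ->
  forall (disp : measure_display) (T : measurableType disp)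
    (mu : probability T R) (W : 'I_k.+1 -> pointedType)
    (F : T -> (forall i, W i) -> R),
    (forall y x, 0 <= F y x <= 1) -> (forall x, measurable_fun setT (F^~ x)) ->
    (forall y, VC_le (W := W) (F y) d) ->
  forall A : forall i : 'I_k, set (W (lift ord_max i)),
    (forall i, (A i #= `I_n)%card) ->
    ~ shattered (W := W) (fun x => \int[mu]_y F y x) (ratr rs.1) (ratr rs.2) A.
  exists (fun r s => D (r, s)) => disp T mu W F F01 mF VCF r s r0 rs s1.
  exact: (DP (r, s)).
case=> r s /=.
have [/and3P[r0 rs s1]|nrs] := boolP [&& 0 <= r, r < s & s <= 1]; last first.
  by exists 0%N => r0 rs s1; rewrite r0 rs s1 in nrs.
(* Shattering yields mean correlation at least [(ratr s - ratr r) / 2], that is [2 * th]; half of it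
   is given up as the slack in [exists_ge_mean]. *)
pose th : R := (ratr s - ratr r) / 4.
have rs' : ratr r < ratr s :> R by rewrite ltr_rat.
have th0 : 0 < th by rewrite /th; lra.
have th1 : th <= 1.
  have : ratr s <= 1 :> R by have := s1; rewrite -(ler_rat R) rmorph1.
  have : 0 <= ratr r :> R by rewrite ler0q.
  by rewrite /th; lra.
have [N [ns [N0 nsk ns0 correlated_box]]] := box_of_correlation k d th0 th1.
pose n := \max_(i < k) nth 0%N ns i.
exists n => _ _ _ disp T mu W F F01 mF VCF A cardA shA.
have [e eA] : exists e : forall i : 'I_k, nat -> W (lift ord_max i),
    forall i, set_bij `I_n (A i) (e i).
  have eE i : exists f : nat -> W (lift ord_max i), set_bij `I_n (A i) f.
    by apply/card_set_bijP; rewrite card_eq_sym.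
  by exists (fun i => sval (cid (eE i))) => i; case: cid.
(* The grid embeds in the box [A], whose sides of [n] points are at least as long as its own. *)
pose pt (a : grid ns) : forall i : 'I_k, W (lift ord_max i) :=
  fun i => e i (grid_coord a i).
have coord_n (a : grid ns) (i : 'I_k) : (grid_coord a i < n)%N.
  apply: leq_trans (grid_coord_lt a _) _; first by rewrite nsk.
  exact: (leq_bigmax i).
have einj i : {in `I_n &, injective (e i)} by have [] := eA i.
have pt_inj : injective pt.
  move=> a b ab; apply: grid_coord_inj => i; rewrite nsk => ik.
  have := congr1 (fun x => x (Ordinal ik)) ab.
  by apply: (einj (Ordinal ik)); rewrite inE/=; exact: (coord_n _ (Ordinal ik)).
have pt_box a : box (W := W) A (pt a).
  by move=> i; have [eI _ _] := eA i; apply: eI; exact: coord_n.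
have /choice[c cP] : forall S : {set grid ns}, exists c : W ord_max,
    forall a, if a \in S
    then \int[mu]_y F y (insert_coord (W := W) c (pt a)) <= ratr r
    else ratr s <= \int[mu]_y F y (insert_coord (W := W) c (pt a)).
  move=> S; have [|c [cS cnS]] := shA [set pt a | a in [set` S]].
    by move=> _ [a _ <-].
  exists c => a; case: ifPn => aS; first by apply: cS; exists a.
  apply: cnS; split; first exact: pt_box.
  by case=> b /= bS /pt_inj ba; rewrite -ba bS in aS.
pose G (Sa : {set grid ns} * grid ns) (y : T) : R :=
  F y (insert_coord (W := W) (c Sa.1) (pt Sa.2)).
have [y yP] : exists y, 2 ^+ #|grid ns| * (th * #|grid ns|%:R) <=
    \sum_(Sa : {set grid ns} * grid ns) set_sign R (Sa.2 \in Sa.1) * G Sa y.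
  apply: (@exists_ge_mean _ _ _ mu _ _ _ _ _
    (2 ^+ #|grid ns| * (2 * th * #|grid ns|%:R))).
  - rewrite ltr_pM2l ?exprn_gt0// ltr_pM2r ?ltr0n//; lra.
  - by move=> Sa; exact: mF.
  - by move=> Sa z; exact: F01.
  rewrite -(pair_bigA _ (fun (S : {set grid ns}) (a : grid ns) =>
    set_sign R (a \in S) * \int[mu]_y G (S, a) y))/=.
  (* [r] and [s] lie at distance [2 * th] from their midpoint, whose contribution cancels because
     the signs sum to zero over [S]. *)
  have -> : 2 ^+ #|grid ns| * (2 * th * #|grid ns|%:R) =
      \sum_(S : {set grid ns}) \sum_(a : grid ns)
        (2 * th + set_sign R (a \in S) * ((ratr r + ratr s) / 2)).
    under eq_bigr do rewrite big_split/= sumr_const -mulr_suml.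
    rewrite big_split/= -mulr_suml.
    have -> : \sum_(S : {set grid ns}) \sum_a set_sign R (a \in S) = 0.
      by rewrite exchange_big big1//= => a _; exact: sum_set_sign.
    rewrite mul0r addr0 sumr_const card_set_type.
    by rewrite -[RHS]mulr_natl natrX -[2 * th *+ _]mulr_natr.
  apply: ler_sum => S _; apply: ler_sum => a _.
  by have := cP S a; rewrite /set_sign /th /G/=; case: ifP => _; lra.
have [||j [B [U [jN [U1 U2] BP]]]] :=
  correlated_box (fun S a => G (S, a) y).
- by move=> S a; exact: F01.
- by apply: (le_trans yP); rewrite [leRHS]pair_bigA/=; apply: ler_sum => -[].
have N0' : 0 < N%:R :> rat by rewrite ltr0n.

(* Consecutive levels are rationals in [0,1], so the bound [d] applies to them at the single point
   [y]. *)
apply: (VCF y (j%:R / N%:R) (j.+1%:R / N%:R) _ _ _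
  (fun i => [set e i m | m in [set` U i]])).
- by rewrite divr_ge0.
- by rewrite ltr_pM2r ?invr_gt0// ltr_nat.
- by rewrite ler_pdivrMr// mul1r ler_nat.
- move=> i; have [Uu <- Un] := U1 i (ltn_ord i).
  apply: card_set_seq_image => // m m' /Un mU /Un m'U; apply: einj; rewrite inE/=.
    have := mU; rewrite mem_iota /= => /leq_trans; apply; exact: (leq_bigmax i).
  have := m'U; rewrite mem_iota /= => /leq_trans; apply; exact: (leq_bigmax i).
move=> S SB; pose X : {set grid ns} := finset (fun a => `[< S (pt a) >]).
have [S' S'P] := BP X; exists (c S').
have realize a : box (W := W) (fun i : 'I_k => [set e i m | m in [set` U i]]) a ->
    exists2 b, b \in B & pt b = a.
  move=> aU; have xE (i : 'I_k) : exists m, m \in U i /\ e i m = a i.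
    by have [m /= mU me] := aU i; exists m.
  have /choice[x xP] := xE.
  (* [x] is extended from ['I_k] to all naturals by 0. *)
  have [i ik|b bB bx] := U2 (fun i => oapp x 0%N (insub i)).
    by rewrite insubT; have [] := xP (Ordinal ik).
  exists b => //; apply/functional_extensionality_dep => i.
  by rewrite /pt bx// valK/=; have [] := xP i.
rewrite !ratr_level; split=> [a aS|a [aB aS]].
  have [b bB ba] := realize a (SB a aS).
  have := S'P b bB; rewrite ifT; last by rewrite inE ba; apply/asboolP.
  by rewrite /G/= ba.
have [b bB ba] := realize a aB.
have := S'P b bB; rewrite ifF; last by rewrite inE ba; apply/asboolP.
by rewrite /G/= ba.
Qed.

(** * Measurability of fibers in graded probability spaces *)

Section Fibers.
Variables (R : realType) (m : nat) (V : 'I_m -> pointedType).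
Variable G : gradedProbSpace R V.

Lemma galg_measurableE (n : 'I_m -> nat) :
  (galg G n).-sigma.-measurable = galg G n.
Proof. exact/measurable_g_measurableTypeE/galg_sigma. Qed.

Lemma measurable_gcat_fiber (n n' : 'I_m -> nat) (h : gpow V (gadd n n') -> R)
    (w : gpow V n') :
  measurable_fun [set: g_sigma_algebraType (galg G (gadd n n'))] h ->
  measurable_fun [set: g_sigma_algebraType (galg G n)] (fun v => h (gcat v w)).
Proof.
move=> mh _ Y mY; have := mh measurableT Y mY.
rewrite !setTI !galg_measurableE => hY; exact: galg_fiber hY w.
Qed.

(** The exponent of ones equals a sum of exponents only propositionally; destructing the equality
    for a variable [n] confines the transport to a [cast_ord]. *)
Lemma measurable_gpow1_cast (n : 'I_m -> nat) (n1 : (fun=> 1%N) = n)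
    (f : (forall i, V i) -> R) :
  measurable_fun [set: g_sigma_algebraType (galg G (fun=> 1%N))]
    (fun v => f (gpow1_point v)) ->
  measurable_fun [set: g_sigma_algebraType (galg G n)]
    (fun v => f (fun i => v i (cast_ord (congr1 (@^~ i) n1) ord0))).
Proof.
case: n / n1 => mf; rewrite [X in measurable_fun _ X](_ : _ =
  (fun v => f (gpow1_point v)))//.
apply/funext => v; congr f; apply/functional_extensionality_dep => i.
by rewrite cast_ord_id.
Qed.

End Fibers.

Lemma measurable_insert_last (R : realType) (k : nat) (V : 'I_k.+2 -> pointedType)
    (G : gradedProbSpace R V) (f : (forall i, V i) -> R)
    (x : forall i : 'I_k.+1, V (lift ord_max i)) :
  measurable_fun [set: g_sigma_algebraType (galg G (fun=> 1%N))]
    (fun v => f (gpow1_point v)) ->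
  measurable_fun [set: g_sigma_algebraType (galg G (gdelta ord_max))]
    (fun v => f (insert_coord (W := fun i => V i) (gdelta_point v) x)).
Proof.
pose n' (i : 'I_k.+2) : nat := i != ord_max.
have n1 : (fun=> 1%N) = gadd (gdelta ord_max) n'.
  by apply/funext => i; rewrite /gadd /gdelta /n'; case: (i == ord_max).
(* The coordinates of [x] are the fixed part of the concatenation. Its block at [ord_max] is empty,
   as [n'] is 0 there, so [point] is only a filler. *)
move=> /(measurable_gpow1_cast n1) /(@measurable_gcat_fiber _ _ _ _ _ n' _
  (fun i _ => insert_coord (W := fun i => V i) (point : V ord_max) x i)).
congr measurable_fun; apply/funext => v; congr f.
apply/functional_extensionality_dep => i; rewrite /gcat.
case: fintype.split => b.
  have iE : ord_max = i.
    have := leq_ltn_trans (leq0n b) (ltn_ord b).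
    by rewrite /gdelta eq_sym lt0b => /eqP.
  case: i / iE b => b; rewrite insert_coord_id /gdelta_point; congr (v _ _).
  apply/val_inj/eqP; rewrite -leqn0 -ltnS (leq_trans (ltn_ord b))//.
  by rewrite /gdelta eqxx.
have [l ->|iE] := unliftP ord_max i; first by rewrite !insert_coord_lift.
by have := leq_ltn_trans (leq0n b) (ltn_ord b); rewrite /n' iE eqxx.
Qed.

Theorem theorem10p7 (R : realType) (k : nat) (k_ge1 : (1 <= k)%N)
    (d : rat -> rat -> nat) :
  exists D : rat -> rat -> nat,
  forall (V : 'I_k.+2 -> pointedType) (G : gradedProbSpace R V)
    (f : (forall i, V i) -> R),
    (forall x, 0 <= f x <= 1) ->
    measurable_fun [set: g_sigma_algebraType (galg G (fun=> 1%N))]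
      (fun v => f (gpow1_point v)) ->
    VC_fibers_le f d ->
    VC_le (W := fun i : 'I_k.+1 => V (lift ord_max i)) (average_last G f) D.
Proof.
have [D DP] := VC_le_average R k d; exists D => V G f f01 mf VCf.
(* The averaging variable is a point of [gpow V (gdelta ord_max)], and the bound on [f] is taken at
   its fibers over the last coordinate. *)
apply: (DP _ _ (gmu G (gdelta ord_max)) (fun i => V (lift ord_max i))
  (fun v x => f (insert_coord (W := fun i => V i) (gdelta_point v) x))).
- by move=> v x; exact: f01.
- by move=> x; exact: measurable_insert_last.
- by move=> v; exact: VCf.
Qed.
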